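(* Let $H$ be the graph with vertex set $V(H)=\{0,1,\ldots,8\}$ and edge set \[ E(H)=\{02,04,07,08,13,14,16,17,23,25,27,35,36,46,47,56\}, \] where $ij$ denotes the edge $\{i,j\}$, and let $G=H+01$ be the graph obtained from $H$ by adding the edge $\{0,1\}$. Then $Z^+_{(1)}(G)=6$.
   Context: PSD color-change rule on a finite simple graph $X$: let $B\subseteq V(X)$ be the current set of blue vertices (all others are white), and let $C$ be the vertex set of a connected component of $X-B$. A blue vertex $x\in B$ may PSD-force a vertex $y\in C$ (turn $y$ blue) when $N_X(x)\cap C=\{y\}$. Forces are applied one after another, recomputing the components of the white graph after each force. A leak is a vertex that is forbidden to perform a force. A set $B\subseteq V(X)$ is a $1$-leaky PSD forcing set of $X$ if, for every choice of a single leak $\lambda\in V(X)$, starting from the initial blue set $B$ there is a sequence of PSD forces, none performed by $\lambda$, after which all vertices of $X$ are blue. $Z^+_{(1)}(X)$ denotes the minimum size of a $1$-leaky PSD forcing set of $X$. *)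

(* Defs.v *)
From mathcomp Require Import all_boot.

Set Implicit Arguments.
Unset Strict Implicit.
Unset Printing Implicit Defensive.

Record sgraph (V : finType) := SGraph {
  adj :> rel V;
  adj_sym : symmetric adj;
  adj_irrefl : irreflexive adj
}.

Section AddEdge.
Variables (V : finType) (X : sgraph V) (a b : V).

Definition add_edge_rel : rel V := fun x y =>
  [|| X x y, (x == a) && (y == b) | (x == b) && (y == a)].

Lemma add_edge_sym : symmetric add_edge_rel.
Proof.
move=> x y; rewrite /add_edge_rel adj_sym; congr (_ || _).
by rewrite orbC [(x == b) && _]andbC [(x == a) && _]andbC.
Qed.

Hypothesis neq_ab : a != b.

Lemma add_edge_irrefl : irreflexive add_edge_rel.
Proof.
move=> x; rewrite /add_edge_rel adj_irrefl /=.
by case: eqP => [->|_] /=; rewrite ?(negbTE neq_ab) ?andbF.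
Qed.

Definition add_edge : sgraph V := SGraph add_edge_sym add_edge_irrefl.

End AddEdge.

Section PSDForcing.
Variables (V : finType) (X : sgraph V).
Implicit Types (B C : {set V}) (x y : V).

Definition neighbours x : {set V} := [set y | X x y].

Definition white_adj B : rel V :=
  fun x y => [&& x \notin B, y \notin B & X x y].

(* Vertex sets of the connected components of X - B; note that
   [connect] is the reflexive-transitive closure. *)
Definition white_components B : {set {set V}} :=
  [set [set z | connect (white_adj B) y z] | y in ~: B].

Definition psd_force B x y : bool :=
  (x \in B) &&
  [exists C in white_components B, neighbours x :&: C == [set y]].

Definition psd_step (leak : V) : rel {set V} := fun B B' =>
  [exists x, exists y,
    [&& x != leak, psd_force B x y & B' == y |: B]].

Definition leaky1_psd_forcing B : bool :=
  [forall leak, connect (psd_step leak) B setT].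

Lemma leaky1_psd_forcingT : leaky1_psd_forcing setT.
Proof. by apply/forallP=> leak; apply: connect0. Qed.

(* [setT] only witnesses that the minimum is over a nonempty family. *)
Definition leaky1_psd_number : nat :=
  #|[arg min_(B < setT | leaky1_psd_forcing B) #|B|]|.

End PSDForcing.

Definition H_edges : seq (nat * nat) :=
  [:: (0, 2); (0, 4); (0, 7); (0, 8); (1, 3); (1, 4); (1, 6); (1, 7);
      (2, 3); (2, 5); (2, 7); (3, 5); (3, 6); (4, 6); (4, 7); (5, 6)].

Definition H_rel : rel 'I_9 := fun i j =>
  ((i : nat, j : nat) \in H_edges) || ((j : nat, i : nat) \in H_edges).

Lemma H_sym : symmetric H_rel.
Proof. by move=> i j; rewrite /H_rel orbC. Qed.

Lemma H_irrefl : irreflexive H_rel.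
Proof. by case; do 9?case=> //. Qed.

Definition H : sgraph 'I_9 := SGraph H_sym H_irrefl.

Definition v0 : 'I_9 := @Ordinal 9 0 isT.
Definition v1 : 'I_9 := @Ordinal 9 1 isT.

Lemma v0_neq_v1 : v0 != v1. Proof. by []. Qed.

Definition G : sgraph 'I_9 := add_edge H v0_neq_v1.

(* Main.v *)
Require Import Defs.
From mathcomp Require Import all_boot.

Set Implicit Arguments.
Unset Strict Implicit.
Unset Printing Implicit Defensive.

(** Call [x] an attacker of [F] when [x] lies outside [F] and has exactly one
    neighbour in [F].  A connected nonempty [F] all of whose attackers equal a
    single vertex must meet every 1-leaky PSD forcing set: with that vertex as
    leak, no force can enter [F] while [F] is entirely white.  Thirty such sets
    in [G] have no common transversal of size 5.  Conversely, every nonempty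
    set of vertices outside [{0,1,2,3,7,8}] has at least two attackers, so with
    any leak the forcing process started there never gets stuck. *)

Section Attackers.
Variables (V : finType) (X : sgraph V).
Implicit Types (B F S : {set V}) (s : seq V) (x y leak : V).

Definition attacker F x := (x \notin F) && (#|neighbours X x :&: F| == 1).

Lemma sub_connect_white_adj B S :
  B \subset S -> subrel (connect (white_adj X S)) (connect (white_adj X B)).
Proof.
move=> sBS; apply: connect_sub => x y /and3P[xS yS xy]; apply: connect1.
by rewrite /white_adj xy !(contra (subsetP sBS _)).
Qed.

Lemma psd_forceP B x y :
  reflect [/\ x \in B, y \notin B, X x y &
           forall z, connect (white_adj X B) y z -> X x z -> z = y]
          (psd_force X B x y).
Proof.
apply: (iffP andP) => [[xB /exists_inP[C]]|[xB yB xy sole]].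
  case/imsetP=> w; rewrite inE => wB -> /eqP nbr_y.
  have: y \in [set y] by rewrite inE.
  rewrite -nbr_y !inE => /andP[xy wy]; split=> //.
    (* Every edge of [white_adj] has white ends, so a path from the white [w] ends at a white
       vertex. *)
    case/connectP: wy => p; case/lastP: p => [_ -> //|p z].
    by rewrite rcons_path last_rcons => /andP[_ /and3P[_ zB _]] ->.
  move=> z yz xz; apply/set1P; rewrite -nbr_y !inE xz.
  exact: connect_trans wy yz.
split=> //; apply/exists_inP.
exists [set z | connect (white_adj X B) y z]; first by rewrite imset_f ?inE.
apply/eqP/setP=> z; rewrite !inE; apply/andP/eqP => [[xz yz]|->].
  exact: sole.
by rewrite xy connect0.
Qed.

(** While [F] is white it lies in one white component, so a vertex forcing into [F] has exactly one
    neighbour there. It is thus an attacker, hence the leak, and [F] stays white forever. *)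
Lemma fort_meets_forcing leak F B :
    F != set0 ->
    {in F &, forall y z, connect (white_adj X (~: F)) y z} ->
    (forall x, attacker F x -> x = leak) ->
  leaky1_psd_forcing X B -> ~~ [disjoint F & B].
Proof.
move=> F0 connF att /forallP/(_ leak)/connectP[p]; elim: p B => [|B' p IHp] B /=.
  by move=> _ <-; rewrite disjoints_subset setCT subset0.
case/andP=> /existsP[x /existsP[y /and3P[xl /psd_forceP[xB yB xy sole]]]].
move=> /eqP-> pathp lastp; have := IHp _ pathp lastp; apply: contraNN => dFB.
rewrite disjoint_sym in dFB.
rewrite disjoint_sym disjoints_subset subUset sub1set inE -disjoints_subset.
rewrite dFB andbT; apply: contra xl => yF; apply/eqP/att/andP; split.
  by rewrite (disjointFr dFB).
apply/cards1P; exists y; apply/setP=> z; rewrite !inE.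
apply/andP/eqP => [[xz zF]|-> //]; apply: sole => //.
apply: sub_connect_white_adj (connF _ _ yF zF).
by rewrite -disjoints_subset.
Qed.

(** A blue vertex with a single white neighbour overall has a single one in that neighbour's
    component, so it may force. Asking for attackers at every [S] above [B] keeps the hypothesis
    valid after each force. *)
Lemma leaky1_psd_forcing_of_attackers B :
    (forall leak S, B \subset S -> S != setT ->
      exists2 x, x != leak & attacker (~: S) x) ->
  leaky1_psd_forcing X B.
Proof.
move=> att; apply/forallP=> leak; have [n] := ubnP #|~: B|.
elim: n => // n IHn in B att *; rewrite ltnS => leBn.
have [-> | BT] := eqVneq B setT; first exact: connect0.
have [x xl] := att leak B (subxx B) BT.
rewrite /attacker inE negbK => /andP[xB /cards1P[y nbr_y]].
have /setIP[] : y \in neighbours X x :&: ~: B by rewrite nbr_y set11.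
rewrite !inE => xy yB; have white z : connect (white_adj X B) y z -> z \notin B.
  case/connectP=> p; case/lastP: p => [_ -> //|p w].
  by rewrite rcons_path last_rcons => /andP[_ /and3P[_ wB _]] ->.
apply: (@connect_trans _ _ (y |: B)).
  apply/connect1/existsP; exists x; apply/existsP; exists y.
  rewrite xl eqxx andbT; apply/psd_forceP; split=> // z yz xz.
  by apply/set1P; rewrite -nbr_y !inE xz white.
apply: IHn => [l S sBS|]; first by apply: att; apply: subset_trans (subsetUr _ _) sBS.
apply: leq_trans leBn; apply: proper_card; rewrite properC properUr //.
by rewrite sub1set.
Qed.

(** A computable certificate of connectedness: reading from the end, each vertex attaches to the
    part already built. *)
Fixpoint chained s :=
  if s is x :: s' then (nilp s' || has (X x) s') && chained s' else true.

Lemma chained_connect s :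
  chained s ->
  {in [set:: s] &, forall y z, connect (white_adj X (~: [set:: s])) y z}.
Proof.
have wsym B : connect_sym (white_adj X B).
  apply: sym_connect_sym => x y.
  by rewrite /white_adj adj_sym andbCA.
elim: s => [_ x|x s IHs /andP[xs /IHs{}IHs]] /=; first by rewrite inE.
set W := ~: _.
have lift y z : y \in s -> z \in s -> connect (white_adj X W) y z.
  move=> ys zs; apply: sub_connect_white_adj (IHs _ _ _ _); rewrite ?inE //.
  by rewrite setCS; apply/subsetP=> w; rewrite !inE orbC => ->.
have head z : z \in s -> connect (white_adj X W) x z.
  move=> zs; case/orP: xs => [/nilP s0|/hasP[w ws xw]]; first by rewrite s0 in zs.
  apply: connect_trans (lift w z ws zs); apply: connect1.
  by rewrite /white_adj !inE eqxx ws xw orbT.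
move=> y z; rewrite !inE => /predU1P[->|ys] /predU1P[->|zs] //.
- exact: head.
- by rewrite wsym; apply: head.
- exact: lift.
Qed.

(** Replaces cardinals by list counts, which [vm_compute] can evaluate. *)
Lemma attacker_seq s x :
  uniq s -> attacker [set:: s] x = (x \notin s) && (count (X x) s == 1).
Proof.
move=> s_uniq; rewrite /attacker inE -size_filter -(card_uniqP (filter_uniq _ s_uniq)).
by congr (_ && (_ == 1)); apply: eq_card => z; rewrite !inE mem_filter.
Qed.

End Attackers.

Definition vtx (i : nat) : 'I_9 := Ordinal (ltn_pmod i (isT : 0 < 9)).

Definition vertices := [seq vtx i | i <- iota 0 9].

Lemma mem_vertices x : x \in vertices.
Proof. by case: x; do 9?case=> //. Qed.

Lemma perm_vertices : perm_eq vertices (enum 'I_9).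
Proof.
by apply: uniq_perm => [||x]; rewrite ?enum_uniq ?mem_enum ?mem_vertices.
Qed.

(* The minimal forts of [G]; each is listed so that every vertex but the last
   is adjacent to a later one. *)
Definition forts := map (map vtx)
  [:: [:: 8]; [:: 7; 0]; [:: 4; 1]; [:: 5; 3]; [:: 2; 3; 1]; [:: 7; 3; 1];
      [:: 5; 2; 1; 0]; [:: 6; 2; 1; 0]; [:: 6; 3; 1; 0]; [:: 5; 6; 1; 0];
      [:: 4; 3; 2; 0]; [:: 6; 3; 2; 0]; [:: 5; 4; 2; 0]; [:: 6; 4; 2; 0];
      [:: 6; 5; 2; 0]; [:: 3; 6; 4; 0]; [:: 5; 6; 4; 0]; [:: 2; 5; 6; 1];
      [:: 5; 2; 7; 1]; [:: 2; 7; 6; 1]; [:: 7; 5; 6; 1]; [:: 4; 6; 3; 2];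
      [:: 4; 7; 3; 2]; [:: 7; 6; 3; 2]; [:: 4; 6; 5; 2]; [:: 4; 7; 5; 2];
      [:: 6; 4; 7; 2]; [:: 7; 6; 5; 2]; [:: 7; 4; 6; 3]; [:: 7; 5; 6; 4]].

(** Decidable form of the hypotheses of [fort_meets_forcing], with the leak found by search; any
    leak serves if there is no attacker. *)
Definition fort (s : seq 'I_9) :=
  [&& s != [::], uniq s, chained G s &
    has (fun leak => all (fun x =>
      (x \notin s) && (count (G x) s == 1) ==> (x == leak)) vertices) vertices].

Lemma forts_fort : all fort forts.
Proof. by vm_compute. Qed.

Lemma fort_hit B s : leaky1_psd_forcing G B -> fort s -> has (mem B) s.
Proof.
move=> forcB /and4P[s0 s_uniq /chained_connect conn /hasP[leak _ /allP att]].
have F0 : [set:: s] != set0.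
  case: s s0 {s_uniq conn att} => // x s _.
  by apply/set0Pn; exists x; rewrite !inE eqxx.
have attF x : attacker G [set:: s] x -> x = leak.
  rewrite attacker_seq // => ax; apply/eqP.
  by have /implyP := att x (mem_vertices x); apply.
have /pred0Pn[x /andP[]] := fort_meets_forcing F0 conn attF forcB.
by rewrite !inE => xs xB; apply/hasP; exists x.
Qed.

Lemma leaky1_psd_forcing_ge6 B : leaky1_psd_forcing G B -> 6 <= #|B|.
Proof.
move=> forcB; have: all (has (mem B)) forts.
  by apply/allP=> s sF; apply: fort_hit forcB (allP forts_fort s sF).
(* Both the hitting condition and the size now depend only on nine membership booleans. *)
have -> : #|B| = count (mem B) vertices.
  by rewrite (permP perm_vertices) -size_filter cardE enumT.
rewrite /forts /vertices /=.
(* In each of the 512 cases, either some fort is missed or the count is at least 6. *)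
do 9![case: (_ \in B) => //=].
Qed.

Definition B6 : {set 'I_9} := [set:: map vtx [:: 0; 1; 2; 3; 7; 8]].

Lemma leaky1_psd_forcing_B6 : leaky1_psd_forcing G B6.
Proof.
apply: leaky1_psd_forcing_of_attackers => leak S sBS ST.
(* The vertices 4, 5, 6 are the complement of [B6], so [s] lists all white vertices. *)
pose s := [seq y <- map vtx [:: 4; 5; 6] | y \notin S].
have s_uniq : uniq s by rewrite filter_uniq.
have sE : ~: S = [set:: s].
  apply/setP=> y; rewrite !inE mem_filter andb_idr // => yS.
  have: y \notin B6 by apply: contra yS; apply: subsetP.
  by rewrite inE; case: y {yS}; do 9?case=> //.
have s0 : s != [::].
  apply: contraNneq ST => s0; rewrite -(setCK S) sE s0.
  by apply/eqP/setP=> y; rewrite !inE.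
(* Quantifying over all leaks makes the claim closed once [s] is known, leaving seven nonempty lists
   to evaluate. *)
pose attacked t := all (fun l => has (fun x =>
  [&& x != l, x \notin t & count (G x) t == 1]) vertices) vertices.
suff: attacked s.
  move/allP/(_ leak (mem_vertices leak))/hasP=> [x _ /andP[xl ax]].
  by exists x => //; rewrite sE attacker_seq.
move: s0; rewrite {sE s_uniq}/s /=.
by do 3![case: (_ \in S)] => //= _; vm_compute.
Qed.

Theorem proposition11 : leaky1_psd_number G = 6.
Proof.
rewrite /leaky1_psd_number; case: arg_minnP => [|B forcB minB].
  exact: leaky1_psd_forcingT.
apply/eqP; rewrite eqn_leq leaky1_psd_forcing_ge6 // andbT.
apply: leq_trans (minB _ leaky1_psd_forcing_B6) _.
by rewrite cardsE (card_uniqP _).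
Qed.
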